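(* $\mathfrak{L}(\mathbf{F}_2)^w_{O(n)} = \mathsf{CF}$.
   Context: For a group $G$ with identity $e$, a $G$-automaton is a tuple $(Q,\Sigma,G,\delta,q_0,Q_a)$ where $Q$ is a finite set of states, $\Sigma$ a finite input alphabet, $q_0\in Q$ the initial state, $Q_a\subseteq Q$ the accepting states, and $\delta$ assigns to each $(q,\sigma)\in Q\times(\Sigma\cup\{\varepsilon\})$ a finite set of pairs $(q',m)\in Q\times G$. The register holds an element of $G$, initially $e$; using a transition $(q',m)\in\delta(q,\sigma)$ (one step) the automaton reads $\sigma$ (or nothing), moves to $q'$ and replaces the register content $x$ by $xm$. A word is accepted if some computation reads it entirely and ends in an accepting state with register equal to $e$. A $G$-automaton recognizing $\mathtt{L}$ is weakly $t(n)$ time-bounded if every $x\in\mathtt{L}$ with $|x|=n$ has an accepting computation of at most $t(n)$ steps; $\mathfrak{L}(G)^w_{O(n)}$ is the class of languages recognized by weakly $t(n)$ time-bounded $G$-automata for some $t(n)=O(n)$. $\mathbf{F}_2$ is the free group of rank 2; $\mathsf{CF}$ is the class of context-free languages. *)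

(* Defs.v *)
From mathcomp Require Import all_boot.
Set Implicit Arguments. Unset Strict Implicit. Unset Printing Implicit Defensive.

(* The free group F_2 of rank 2: reduced words over the letters         *)
(* a, a^-1, b, b^-1, encoded as (i, s) : 'I_2 * bool (generator i,      *)
(* s = true meaning inverse).  Product = free reduction of the          *)
(* concatenation; identity = empty word.                                *)
Definition letter := ('I_2 * bool)%type.
Definition linv (l : letter) : letter := (l.1, ~~ l.2).

Definition reducedb (w : seq letter) : bool :=
  sorted (fun x y => y != linv x) w.

Definition red_push (l : letter) (w : seq letter) : seq letter :=
  match w with
  | x :: w' => if x == linv l then w' else l :: w
  | [::] => [:: l]
  end.

Definition reduce (w : seq letter) : seq letter := foldr red_push [::] w.

Lemma red_push_reduced l w : reducedb w -> reducedb (red_push l w).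
Proof.
case: w => [|x w] //= Hw.
case: ifP => Hx; first exact: path_sorted Hw.
by rewrite /reducedb /= Hx Hw.
Qed.

Lemma reduce_reduced w : reducedb (reduce w).
Proof. by elim: w => [|l w IH] //=; apply: red_push_reduced. Qed.

Definition F2 := {w : seq letter | reducedb w}.

Definition F2_one : F2 := exist _ [::] (erefl true).
Definition F2_mul (x y : F2) : F2 :=
  exist _ (reduce (val x ++ val y)) (reduce_reduced _).

(* delta q None = epsilon transitions, delta q (Some a) = reading a.    *)
Record gautomaton (G : eqType) (Sigma : finType) := GAutomaton {
  gstate : finType;
  gdelta : gstate -> option Sigma -> seq (gstate * G);
  ginit : gstate;
  gacc : {set gstate}
}.

Section GAut.
Variables (G : eqType) (mul : G -> G -> G) (e : G) (Sigma : finType).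
Variable A : gautomaton G Sigma.

Inductive gsteps : gstate A -> G -> seq Sigma -> nat -> gstate A -> G -> Prop :=
| gsteps_nil q x : gsteps q x [::] 0 q x
| gsteps_eps q x q1 m w k q' x' :
    (q1, m) \in gdelta q None ->
    gsteps q1 (mul x m) w k q' x' -> gsteps q x w k.+1 q' x'
| gsteps_read q x a q1 m w k q' x' :
    (q1, m) \in gdelta q (Some a) ->
    gsteps q1 (mul x m) w k q' x' -> gsteps q x (a :: w) k.+1 q' x'.

Definition gaccepts_in (w : seq Sigma) (k : nat) : Prop :=
  exists2 qf, qf \in gacc A & gsteps (ginit A) e w k qf e.

Definition gaccepts (w : seq Sigma) : Prop := exists k, gaccepts_in w k.

Definition grecognizes (L : seq Sigma -> Prop) : Prop :=
  forall w, L w <-> gaccepts w.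

Definition weakly_time_bounded (L : seq Sigma -> Prop) (t : nat -> nat) : Prop :=
  forall w, L w -> exists2 k, k <= t (size w) & gaccepts_in w k.
End GAut.

Definition linear_bound (t : nat -> nat) : Prop :=
  exists c N, forall n, N <= n -> t n <= c * n.

Definition in_LGw_lin (G : eqType) (mul : G -> G -> G) (e : G)
    (Sigma : finType) (L : seq Sigma -> Prop) : Prop :=
  exists (A : gautomaton G Sigma) (t : nat -> nat),
    [/\ grecognizes mul e A L, linear_bound t & weakly_time_bounded mul e A L t].

Record cfg (Sigma : finType) := CFG {
  nonterm : finType;
  cstart : nonterm;
  crules : seq (nonterm * seq (nonterm + Sigma))
}.

Section CFG.
Variables (Sigma : finType) (g : cfg Sigma).

Inductive cstep : seq (nonterm g + Sigma) -> seq (nonterm g + Sigma) -> Prop :=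
| cstep_rule u v X rhs : (X, rhs) \in crules g ->
    cstep (u ++ inl X :: v) (u ++ rhs ++ v).

Inductive cderives : seq (nonterm g + Sigma) -> seq (nonterm g + Sigma) -> Prop :=
| cderives_refl s : cderives s s
| cderives_step s1 s2 s3 : cstep s1 s2 -> cderives s2 s3 -> cderives s1 s3.

Definition cfg_lang (w : seq Sigma) : Prop :=
  cderives [:: inl (cstart g)] (map inr w).
End CFG.

Definition is_CF (Sigma : finType) (L : seq Sigma -> Prop) : Prop :=
  exists g : cfg Sigma, forall w, L w <-> cfg_lang g w.

(* Main.v *)
Require Import Defs.
From mathcomp Require Import all_boot zify.
From Stdlib Require Import Classical.
Set Implicit Arguments. Unset Strict Implicit. Unset Printing Implicit Defensive.

(* Both inclusions go through finite transition systems whose steps are labelled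
   by letters of a finitely generated free group.  A run whose label word freely
   reduces to 1 is balanced: it is a concatenation of reading steps and of blocks
   l ... l^-1 around a balanced run.  The words read by balanced runs from [s] to
   [t] form a context-free language, with one nonterminal per pair (s, t); this
   covers every F_2-automaton, whatever its running time.

   Conversely a grammar is simulated by a top-down parser on dotted items, which
   pushes the current item before expanding a nonterminal and pops it when the
   expansion is completed.  The group also cancels p^-1 ... p, but this never
   happens: after popping the item p the parser is strictly further right in the
   same rule and can only push later items.  The stack alphabet, of any finite
   size, embeds into F_2 as conjugates of b by powers of a.

   The running time is the cost of a derivation, and an arbitrary grammar (with
   empty and unit rules) derives a word w at a cost O(|w|) + O(1): an erased
   nonterminal costs at most a constant E, a chain of unit steps between two
   given nonterminals can be chosen of cost at most a constant K, and between
   chains the word is split into shorter pieces. *)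

(** * Free reduction *)

Section FreeReduction.
Variable T : eqType.
Implicit Types (l x : T * bool) (u v z r : seq (T * bool)).

Definition sinv l : T * bool := (l.1, ~~ l.2).

Definition fpush l u :=
  if u is x :: u' then if x == sinv l then u' else l :: u else [:: l].

Definition freduce z := foldr fpush [::] z.

Definition freduced u := sorted (fun x y => y != sinv x) u.

Lemma sinvK : involutive sinv.
Proof. by case=> a s; rewrite /sinv /= negbK. Qed.

Lemma fpush_reduced l u : freduced u -> freduced (fpush l u).
Proof.
case: u => [|x u] //= Hu.
by case: ifP => Hx; [exact: path_sorted Hu | rewrite /freduced /= Hx Hu].
Qed.

Lemma freduce_reduced z : freduced (freduce z).
Proof. by elim: z => //= l z; apply: fpush_reduced. Qed.

Lemma fpushK l u : freduced u -> fpush l (fpush (sinv l) u) = u.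
Proof.
case: u => [|x u] /=; first by rewrite eqxx.
rewrite sinvK; case: (x =P l) => [->|_] Hu; last by rewrite /= eqxx.
case: u Hu => //= y u /andP[Hy _]; by rewrite (negbTE Hy).
Qed.

Lemma freduced_id u : freduced u -> freduce u = u.
Proof.
elim: u => //= x u IH Hxu; rewrite IH; last exact: path_sorted Hxu.
by case: u {IH} Hxu => //= y u /andP[/negbTE -> _].
Qed.

(** When opposite letters undo each other on the invariant set [R], the letters act as a free group,
    so the outcome depends only on the reduced word. This serves for [fpush], for [F2_act] and for
    the codes of letters. *)
Lemma foldr_freduce (X : Type) (R : X -> Prop) (f : T * bool -> X -> X) :
  (forall l (x : X), R x -> R (f l x)) ->
  (forall l (x : X), R x -> f l (f (sinv l) x) = x) ->
  forall z (x : X), R x -> foldr f x (freduce z) = foldr f x z.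
Proof.
move=> fR fK z x Rx; elim: z => //= l z <-.
case: (freduce z) => //= y u; case: eqP => // ->.
by rewrite fK //; elim: u => //= y' u; apply: fR.
Qed.

Lemma foldr_fpush_freduce z u :
  freduced u -> foldr fpush u (freduce z) = foldr fpush u z.
Proof.
exact: (foldr_freduce (R := freduced) fpush_reduced fpushK).
Qed.

Lemma freduce_cat z1 z2 :
  freduce (z1 ++ z2) = foldr fpush (freduce z2) (freduce z1).
Proof.
rewrite foldr_fpush_freduce; last exact: freduce_reduced.
by rewrite /freduce foldr_cat.
Qed.

(** The head of the reduced word is a surviving letter, and all that precedes it cancels. If the
    first letter of [z] is itself cancelled, the induction is used twice: to find its partner, then
    to find [x] behind the partner. *)
Lemma freduce_head z x r : freduce z = x :: r ->
  exists z1 z2, [/\ z = z1 ++ x :: z2, freduce z1 = [::] & freduce z2 = r].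
Proof.
have [n] := ubnP (size z); elim: n z x r => // n IH [|y z] x r //= ltzn.
case zE: (freduce z) => [|y' u] /=.
  by case=> <- <-; exists [::], z.
case: eqP => [y'E uE|_ [<- <-]]; last by exists [::], z.
have [z1 [z2 [z12 z1E z2E]]] := IH _ _ _ ltzn zE.
have [|z3 [z4 [z34 z3E z4E]]] := IH z2 x r _ (etrans z2E uE).
  by move: ltzn; rewrite z12 size_cat /=; lia.
exists (y :: z1 ++ y' :: z3), z4; split=> //.
  by rewrite z12 z34 /= -catA.
by rewrite /= freduce_cat z1E /= z3E /= y'E eqxx.
Qed.

Lemma freduce_nil_cons l z : freduce (l :: z) = [::] ->
  exists z1 z2, [/\ z = z1 ++ sinv l :: z2, freduce z1 = [::] & freduce z2 = [::]].
Proof.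
rewrite /=; case zE: (freduce z) => [|y u] //=; case: eqP => // yE uE.
by apply: freduce_head; rewrite zE yE uE.
Qed.

End FreeReduction.

Lemma freduce_cat_freduce (T : eqType) (u v : seq (T * bool)) :
  freduce (freduce u ++ v) = freduce (u ++ v).
Proof. by rewrite !freduce_cat (freduced_id (freduce_reduced u)). Qed.

Lemma freduce_freduce_cat (T : eqType) (u v : seq (T * bool)) :
  freduce (u ++ freduce v) = freduce (u ++ v).
Proof. by rewrite !freduce_cat (freduced_id (freduce_reduced v)). Qed.

Lemma F2_mulE (x y : F2) : val (F2_mul x y) = freduce (val x ++ val y).
Proof. by []. Qed.

Lemma freduce_val (x : F2) : freduce (val x) = val x.
Proof. exact: freduced_id (valP x). Qed.

(** * Balanced runs *)

Section LabelledRuns.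
Variables (Sigma T S : finType).
Variable rd : S -> option Sigma -> S -> bool.
Variable lt : S -> T * bool -> S -> bool.

Definition ocons (o : option Sigma) w := if o is Some a then a :: w else w.

Inductive lrun : S -> seq Sigma -> seq (T * bool) -> nat -> S -> Prop :=
| lrun_nil s : lrun s [::] [::] 0 s
| lrun_read s o s1 w z n t :
    rd s o s1 -> lrun s1 w z n t -> lrun s (ocons o w) z n.+1 t
| lrun_letter s l s1 w z n t :
    lt s l s1 -> lrun s1 w z n t -> lrun s w (l :: z) n.+1 t.

Inductive balanced : S -> seq Sigma -> nat -> S -> Prop :=
| bal_nil s : balanced s [::] 0 s
| bal_read s o s1 w n t :
    rd s o s1 -> balanced s1 w n t -> balanced s (ocons o w) n.+1 t
| bal_pair s l s1 w1 n1 s2 s3 w2 n2 t :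
    lt s l s1 -> balanced s1 w1 n1 s2 -> lt s2 (sinv l) s3 ->
    balanced s3 w2 n2 t -> balanced s (w1 ++ w2) (n1 + n2).+2 t.

Lemma lrun_cat s w1 z1 n1 t w2 z2 n2 r :
  lrun s w1 z1 n1 t -> lrun t w2 z2 n2 r ->
  lrun s (w1 ++ w2) (z1 ++ z2) (n1 + n2) r.
Proof.
elim=> // [{}s o s1 w z n {}t rs _ IH /IH h | {}s l s1 w z n {}t ls _ IH /IH h].
  by case: o rs => [a|] rs /=; apply: lrun_read rs h.
exact: lrun_letter ls h.
Qed.

Lemma lrun_split s w z1 l z2 n r : lrun s w (z1 ++ l :: z2) n r ->
  exists s1 s2 w1 w2 n1 n2,
   [/\ w = w1 ++ w2, n = (n1 + n2).+1, lrun s w1 z1 n1 s1, lt s1 l s2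
     & lrun s2 w2 z2 n2 r].
Proof.
move zE: (z1 ++ l :: z2) => z h; elim: h z1 zE => [{}s|{}s o s1 {}w {}z {}n t rs _ IH|].
- by case.
- move=> z1 /IH [s2 [s3 [w1 [w2 [n1 [n2 [-> -> h1 h2 h3]]]]]]].
  exists s2, s3, (ocons o w1), w2, n1.+1, n2; split=> //.
    by case: (o).
  exact: lrun_read rs h1.
- move=> {}s l' s1 {}w {}z {}n t ls h IH [|x z1] /= [].
    by move=> -> ->; exists s, s1, [::], w, 0, n; split=> //; exact: lrun_nil.
  move=> -> /IH [s2 [s3 [w1 [w2 [n1 [n2 [-> -> h1 h2 h3]]]]]]].
  exists s2, s3, w1, w2, n1.+1, n2; split=> //.
  exact: lrun_letter ls h1.
Qed.

(** The first label is cancelled by a matching inverse, which cuts the run into an enclosed part and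
    a remainder, both shorter and with trivial labels. *)
Lemma lrun_balanced s w z n t :
  lrun s w z n t -> freduce z = [::] -> balanced s w n t.
Proof.
have [m] := ubnP n; elim: m s w z n t => // m IH s w z n t ltnm h.
case: h ltnm => {s w z n t} [s|s o s1 w z n t rs h|s l s1 w z n t ls h] ltnm z0.
- exact: bal_nil.
- by apply: (bal_read rs); apply: IH h z0.
- have [z1 [z2 [z12 z1E z2E]]] := freduce_nil_cons z0.
  rewrite z12 in h; have [s2 [s3 [w1 [w2 [n1 [n2 [wE nE h1 h2 h3]]]]]]] := lrun_split h.
  rewrite wE nE; apply: (bal_pair ls _ h2).
    by apply: IH h1 z1E; lia.
  by apply: IH h3 z2E; lia.
Qed.

Lemma balanced_lrun s w n t : balanced s w n t ->
  exists2 z, lrun s w z n t & freduce z = [::].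
Proof.
elim=> {s w n t} [s|s o s1 w n t rs _ [z h z0]|].
- by exists [::] => //; exact: lrun_nil.
- by exists z => //; exact: lrun_read rs h.
- move=> s l s1 w1 n1 s2 s3 w2 n2 t l1 _ [z1 h1 z1E] l2 _ [z2 h2 z2E].
  exists (l :: z1 ++ sinv l :: z2).
    rewrite -addnS; apply: (lrun_letter l1); apply: lrun_cat h1 _.
    exact: lrun_letter l2 h2.
  by rewrite /= freduce_cat z1E /= z2E /= eqxx.
Qed.

End LabelledRuns.

(** * Automata over the free group of rank 2 *)

(* The letters of the free group on a finite set [T] are encoded in F_2 by
   conjugates of [b] and [b^-1] by powers of [a].  That the encoding is injective is
   seen on an action of F_2 on pairs (a point of [T], a reduced word): [a] moves
   the point along a cyclic order of [T], and [b] pushes the current point. *)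
Section Encoding.
Variable T : finType.

Definition F2_act (l : letter) (x : T * seq (T * bool)) :=
  if l.1 == ord0
  then (if l.2 then prev (enum T) x.1 else next (enum T) x.1, x.2)
  else (x.1, fpush (x.1, l.2) x.2).

(** [T] may be empty, so a point is supplied as default; the result does not depend on it. *)
Definition base (t : T) := head t (enum T).

Definition exponent (t : T) := findex (next (enum T)) (base t) t.

(** Under [foldr] the rightmost letters act first: a^k brings the base point to [l.1], then b or
    b^-1 pushes there, and a^-k returns. *)
Definition code (l : T * bool) : seq letter :=
  nseq (exponent l.1) (ord0, true) ++
  (ord_max, l.2) :: nseq (exponent l.1) (ord0, false).

Definition codes (z : seq (T * bool)) := flatten (map code z).

Lemma F2_act_reduced l x : freduced x.2 -> freduced (F2_act l x).2.
Proof. by rewrite /F2_act; case: ifP => //= _; apply: fpush_reduced. Qed.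

Lemma F2_actK l x : freduced x.2 -> F2_act l (F2_act (sinv l) x) = x.
Proof.
case: x => t u /=; rewrite /F2_act /=; case: eqP => _ /=.
  by case: l.2 => _ /=; rewrite ?next_prev ?prev_next ?enum_uniq.
by move=> Hu; rewrite (fpushK (t, l.2)).
Qed.

Lemma foldr_nseq (A B : Type) (f : A -> B -> B) n a x :
  foldr f x (nseq n a) = iter n (f a) x.
Proof. by elim: n => //= n ->. Qed.

Lemma iter_exponent t : iter (exponent t) (next (enum T)) (base t) = t.
Proof.
apply: iter_findex; rewrite (fconnect_cycle (p := enum T)) ?mem_enum //.
by apply: cycle_next; apply: enum_uniq.
Qed.

Lemma iter_cancel (X : Type) (R : X -> Prop) (f g : X -> X) k x :
  (forall y, R y -> R (g y)) -> (forall y, R y -> f (g y) = y) ->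
  R x -> iter k f (iter k g x) = x.
Proof.
move=> gR fgK Rx; elim: k => // k IH; rewrite iterSr iterS fgK //.
by elim: (k) => //= n; apply: gR.
Qed.

Lemma F2_act_code t l u : freduced u ->
  foldr F2_act (base t, u) (code l) = (base t, fpush l u).
Proof.
have -> : base t = base l.1.
  by rewrite /base; case: (enum T) (mem_enum T t) => //; rewrite inE.
case: l => {}t s Hu.
rewrite /code foldr_cat /= !foldr_nseq.
set k := exponent t.
have nextE v : iter k (F2_act (ord0, false)) (base t, v) = (t, v).
  transitivity (iter k (next (enum T)) (base t), v); last by rewrite iter_exponent.
  by elim: (k) => // i IH; rewrite !iterS IH.
rewrite nextE.
have -> : F2_act (ord_max, s) (t, u) = (t, fpush (t, s) u) by [].
rewrite -nextE; apply: (iter_cancel (R := fun x => freduced x.2)).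
- by move=> y; apply: F2_act_reduced.
- by move=> y; apply: (@F2_actK (ord0, true)).
- exact: fpush_reduced.
Qed.

Lemma F2_act_codes t z :
  foldr F2_act (base t, [::]) (codes z) = (base t, freduce z).
Proof.
elim: z => //= l z IH; rewrite foldr_cat IH F2_act_code //.
exact: freduce_reduced.
Qed.

(** Acting on the empty word at the base point, [codes z] produces [freduce z]; but the action sees
    [codes z] only up to free reduction. *)
Lemma codes_inj z : freduce (codes z) = [::] -> freduce z = [::].
Proof.
case: z => // l z cz; have := F2_act_codes l.1 (l :: z).
rewrite -(foldr_freduce (R := fun x => freduced x.2) F2_act_reduced F2_actK) // cz.
by case.
Qed.

Lemma code_sinv l u : freduced u ->
  foldr (@fpush _) (foldr (@fpush _) u (code (sinv l))) (code l) = u.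
Proof.
have powK k (a : letter) v : freduced v ->
    iter k (@fpush _ a) (iter k (@fpush _ (sinv a)) v) = v.
  apply: (iter_cancel (R := @freduced _)) => y Hy; last exact: fpushK.
  exact: fpush_reduced.
move=> Hu; rewrite /code !foldr_cat /= !foldr_nseq.
set v := iter _ _ u.
have Hv : freduced v.
  by rewrite /v; elim: (exponent _) => //= n; apply: fpush_reduced.
rewrite (powK _ (ord0, false)); last exact: fpush_reduced.
rewrite (fpushK (ord_max, l.2)) //.
exact: (powK _ (ord0, true)).
Qed.

(** Codes act on the reduced words of F_2 by left multiplication, and opposite letters have inverse
    actions, so [foldr_freduce] applies once more. *)
Lemma freduce_codes z : freduce z = [::] -> freduce (codes z) = [::].
Proof.
pose f l u := foldr (@fpush _) u (code l).
have fE u y : foldr (@fpush _) u (codes y) = foldr f u y.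
  by elim: y => //= l y IH; rewrite foldr_cat IH.
move=> z0; rewrite [LHS]fE -(foldr_freduce (R := @freduced _)) ?z0 //.
  by move=> l u Hu; rewrite /f; elim: (code l) => //= a y; apply: fpush_reduced.
by move=> l u Hu; apply: code_sinv.
Qed.

End Encoding.

(** * From labelled transition systems to F_2-automata *)

Section LabelledAutomaton.
Variables (Sigma T S : finType).
Variable rd : S -> option Sigma -> S -> bool.
Variable lt : S -> T * bool -> S -> bool.
Variables (s0 : S) (F : {set S}).

Definition encode (l : T * bool) : F2 := exist _ (reduce (code l)) (reduce_reduced _).

Definition labelled_delta (s : S) (o : option Sigma) : seq (S * F2) :=
  [seq (s1, F2_one) | s1 <- enum S & rd s o s1] ++
  (if o is None
   then [seq (p.1, encode p.2) | p <- enum {: S * (T * bool)} & lt s p.2 p.1]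
   else [::]).

Definition labelled_aut : gautomaton F2 Sigma :=
  @GAutomaton F2 Sigma S labelled_delta s0 F.

Lemma labelled_deltaP s o s1 m :
  reflect ((rd s o s1 /\ m = F2_one) \/
           (o = None /\ exists2 l, lt s l s1 & m = encode l))
          ((s1, m) \in labelled_delta s o).
Proof.
rewrite mem_cat; apply: (iffP orP) => [[]|[[rs ->]|[-> [l ls ->]]]].
- by case/mapP=> s'; rewrite mem_filter => /andP[rs _] [-> ->]; left.
- case: o => // /mapP[[s' l]]; rewrite mem_filter => /andP[/= ls _] [-> ->].
  by right; split=> //; exists l.
- by left; apply: map_f; rewrite mem_filter rs mem_enum.
- by right; apply: (map_f (fun p : S * (T * bool) => (p.1, encode p.2)) (x := (s1, l)));
     rewrite mem_filter ls mem_enum.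
Qed.

Lemma F2_mul1 x : F2_mul x F2_one = x.
Proof. by apply: val_inj; rewrite F2_mulE cats0 freduce_val. Qed.

Lemma F2_mul_encode x l : val (F2_mul x (encode l)) = freduce (val x ++ code l).
Proof. exact: freduce_freduce_cat. Qed.

Lemma gsteps_lrun s x w k t y :
  gsteps F2_mul (A := labelled_aut) s x w k t y ->
  exists2 z, lrun rd lt s w z k t & val y = freduce (val x ++ codes z).
Proof.
elim=> {s x w k t y} [s x|s x s1 m w k t y|s x a s1 m w k t y].
- by exists [::]; [exact: lrun_nil | rewrite cats0 freduce_val].
- move=> /labelled_deltaP[[rs ->]|[_ [l ls ->]]] _ [z h].
    by rewrite F2_mul1 => ->; exists z => //; exact: (lrun_read (o := None) rs h).
  rewrite F2_mul_encode freduce_cat_freduce -catA => ->.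
  by exists (l :: z) => //; exact: lrun_letter ls h.
- move=> /labelled_deltaP[[rs ->]|[//]] _ [z h].
  by rewrite F2_mul1 => ->; exists z => //; exact: (lrun_read (o := Some a) rs h).
Qed.

Lemma lrun_gsteps s w z k t : lrun rd lt s w z k t -> forall x y,
  val y = freduce (val x ++ codes z) ->
  gsteps F2_mul (A := labelled_aut) s x w k t y.
Proof.
elim=> {s w z k t} [s|s o s1 w z k t rs _ IH|s l s1 w z k t ls _ IH] x y yE.
- suff -> : y = x by exact: gsteps_nil.
  by apply: val_inj; rewrite yE cats0 freduce_val.
- have mem : (s1, F2_one) \in gdelta (g := labelled_aut) s o.
    by apply/labelled_deltaP; left.
  case: o mem {rs} => [a|] mem /=.
    by apply: (gsteps_read (m := F2_one) mem); rewrite F2_mul1; apply: IH.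
  by apply: (gsteps_eps (m := F2_one) mem); rewrite F2_mul1; apply: IH.
- apply: (gsteps_eps (q1 := s1 : gstate labelled_aut) (m := encode l)).
    by apply/labelled_deltaP; right; split=> //; exists l.
  by apply: IH; rewrite F2_mul_encode freduce_cat_freduce -catA.
Qed.

(** The same [k] stands on both sides, since each step of the transition system is one step of the
    automaton; this is what transfers the time bound. *)
Lemma labelled_aut_accepts w k :
  gaccepts_in F2_mul F2_one labelled_aut w k <->
  exists2 t, t \in F & balanced rd lt s0 w k t.
Proof.
split=> [[t Ft /gsteps_lrun[z h zE]]|[t Ft /balanced_lrun[z h z0]]]; exists t => //.
  by apply: lrun_balanced h _; apply: codes_inj; rewrite -[LHS]/(freduce ([::] ++ codes z)) -zE.
by apply: lrun_gsteps h _ _ _; rewrite /= freduce_codes.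
Qed.

End LabelledAutomaton.

(** * From F_2-automata to labelled transition systems *)

Section PendingWord.
Variables (Sigma : finType) (A : gautomaton F2 Sigma).

Definition delta_bound :=
  \max_(p : gstate A * option Sigma) \max_(m <- @gdelta _ _ A p.1 p.2) size (val m.2).

(* A state together with a word of letters still to be multiplied. *)
Definition pstate : finType := (gstate A * delta_bound.-bseq letter)%type.

Definition pending (q : gstate A) (u : seq letter) : pstate :=
  (q, insub_bseq delta_bound u).

Definition pend_read (s : pstate) (o : option Sigma) (t : pstate) : bool :=
  nilp s.2 && has (fun m => (m.1 == t.1) && (val m.2 == t.2 :> seq letter)) (@gdelta _ _ A s.1 o).

Definition pend_letter (s : pstate) (l : letter) (t : pstate) : bool :=
  (s.1 == t.1) && (s.2 == l :: t.2 :> seq letter).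

Definition pend_acc : {set pstate} := [set s : pstate | (s.1 \in gacc A) && nilp s.2].

Lemma delta_boundP q o q1 m : (q1, m) \in @gdelta _ _ A q o -> size (val m) <= delta_bound.
Proof.
by move=> qm; apply: (bigmax_sup (q, o)) => //; apply: (bigmaxn_sup_seq (q1, m)).
Qed.

Lemma val_pending q u : size u <= delta_bound -> (pending q u).2 = u :> seq letter.
Proof. by move=> ub; rewrite /pending /= /insub_bseq insubdK. Qed.

Lemma lrun_pending q u w z k t : size u <= delta_bound ->
  lrun pend_read pend_letter (pending q [::]) w z k t ->
  exists k', lrun pend_read pend_letter (pending q u) w (u ++ z) k' t.
Proof.
move=> + h; elim: u => [|l u IH] ub; first by exists k.
have [k' h'] := IH (ltnW ub); exists k'.+1; apply: lrun_letter h'.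
by rewrite /pend_letter eqxx /= !val_pending ?eqxx //; exact: ltnW.
Qed.

Lemma gsteps_pend q x w k t y : gsteps F2_mul (A := A) q x w k t y ->
  exists2 z, val y = freduce (val x ++ z) &
    exists k', lrun pend_read pend_letter (pending q [::]) w z k' (pending t [::]).
Proof.
have step o q1 q2 (x1 m : F2) w1 t1 (y1 : F2) z : (q2, m) \in @gdelta _ _ A q1 o ->
    val y1 = freduce (val (F2_mul x1 m) ++ z) ->
    (exists k', lrun pend_read pend_letter (pending q2 [::]) w1 z k' t1) ->
  exists2 z', val y1 = freduce (val x1 ++ z') &
    exists k', lrun pend_read pend_letter (pending q1 [::]) (ocons o w1) z' k' t1.
  move=> qm yE [k1 h]; exists (val m ++ z).
    by rewrite yE F2_mulE freduce_cat_freduce catA.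
  have mb := delta_boundP qm; have [k2 h2] := lrun_pending mb h.
  exists k2.+1; apply: lrun_read h2.
  rewrite /pend_read val_pending //=; apply/hasP; exists (q2, m) => //=.
  by rewrite eqxx; apply/eqP/esym/(val_pending q2).
elim=> {q x w k t y} [q x|q x q1 m w k t y qm _ [z]|q x a q1 m w k t y qm _ [z]].
- by exists [::]; [rewrite cats0 freduce_val | exists 0; exact: lrun_nil].
- exact: (step None _ _ _ _ _ _ _ _ qm).
- exact: (step (Some a) _ _ _ _ _ _ _ _ qm).
Qed.

(** Generalised to runs that start in the middle of a multiplication: [x] is the product of the
    letters processed so far, and [y] is the register of [A], which already contains the whole
    pending word. *)
Lemma pend_gsteps s w z k t :
  lrun pend_read pend_letter s w z k t -> nilp t.2 -> forall x y y' : F2,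
  val y = freduce (val x ++ s.2) -> val y' = freduce (val x ++ z) ->
  exists k', gsteps F2_mul (A := A) s.1 y w k' t.1 y'.
Proof.
elim=> {s w z k t} [s|s o s1 w z k t|s l s1 w z k t].
- move=> /nilP s0 x y y' yE y'E.
  have -> : y' = y by apply: val_inj; rewrite yE y'E s0.
  by exists 0; exact: gsteps_nil.
- case/andP=> /nilP s0 /hasP[[q m] qm /andP[/eqP qE /eqP mE]] _ IH tn x y y' yE y'E.
  have {}yE : y = x by apply: val_inj; rewrite yE s0 cats0 freduce_val.
  have [|k' h] := IH tn x (F2_mul y m) y' _ y'E.
    by rewrite yE F2_mulE mE.
  exists k'.+1; rewrite -qE in h; case: o qm => [a|] qm.
    exact: gsteps_read qm h.
  exact: gsteps_eps qm h.
- case/andP=> /eqP -> /eqP sE _ IH tn x y y' yE y'E.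
  pose x1 : F2 := exist _ (freduce (val x ++ [:: l])) (reduce_reduced _).
  apply: (IH tn x1); rewrite /= freduce_cat_freduce -catA //.
  by rewrite yE sE.
Qed.

Lemma gaccepts_pend w :
  gaccepts F2_mul F2_one A w <->
  exists t k, t \in pend_acc /\
    balanced pend_read pend_letter (pending (ginit A) [::]) w k t.
Proof.
split=> [[k [t Ft /gsteps_pend[z zE [k' h]]]]|[t [k [Ft /balanced_lrun[z h z0]]]]].
  exists (pending t [::]), k'; split; first by rewrite inE Ft /= val_pending.
  exact: lrun_balanced h (esym zE).
move: Ft; rewrite inE => /andP[Ft tn].
have [||k' h'] := pend_gsteps h tn (x := F2_one) (y := F2_one) (y' := F2_one).
- by rewrite val_pending.
- by rewrite /= z0.
- by exists k', t.1.
Qed.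

End PendingWord.

(** * Context-free grammars *)

Section Yields.
Variables (Sigma : finType) (g : cfg Sigma).
Implicit Types (s : seq (nonterm g + Sigma)) (w : seq Sigma).

(* The cost counts a terminal once and a nonterminal twice (a push and a pop). *)
Inductive yields : seq (nonterm g + Sigma) -> seq Sigma -> nat -> Prop :=
| yields_nil : yields [::] [::] 0
| yields_term a s w k : yields s w k -> yields (inr a :: s) (a :: w) k.+1
| yields_nonterm X rhs s w1 k1 w2 k2 :
    (X, rhs) \in crules g -> yields rhs w1 k1 -> yields s w2 k2 ->
    yields (inl X :: s) (w1 ++ w2) (k1 + k2).+2.

Lemma yields_nilE w k : yields [::] w k -> w = [::] /\ k = 0.
Proof. by move sE: [::] => s h; case: h sE. Qed.

Lemma yields_termE a s w k : yields (inr a :: s) w k ->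
  exists w' k', [/\ w = a :: w', k = k'.+1 & yields s w' k'].
Proof.
move rE: (inr a :: s) => r h; case: h rE => // b s' w' k' h [-> ->].
by exists w', k'.
Qed.

Lemma yields_nontermE X s w k : yields (inl X :: s) w k ->
  exists rhs w1 k1 w2 k2,
    [/\ w = w1 ++ w2, k = (k1 + k2).+2, (X, rhs) \in crules g,
        yields rhs w1 k1 & yields s w2 k2].
Proof.
move rE: (inl X :: s) => r h; case: h rE => // Y rhs s' w1 k1 w2 k2 Yr h1 h2 [-> ->].
by exists rhs, w1, k1, w2, k2.
Qed.

Lemma yields1 X rhs w k :
  (X, rhs) \in crules g -> yields rhs w k -> yields [:: inl X] w k.+2.
Proof.
by move=> Xr h; move: (yields_nonterm Xr h yields_nil); rewrite cats0 addn0.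
Qed.

Lemma yields1E X w k : yields [:: inl X] w k ->
  exists rhs k', [/\ k = k'.+2, (X, rhs) \in crules g & yields rhs w k'].
Proof.
case/yields_nontermE=> rhs [w1 [k1 [w2 [k2 [-> -> Xr h /yields_nilE[-> ->]]]]]].
by exists rhs, k1; rewrite cats0 addn0.
Qed.

Lemma yields_cat s1 w1 k1 s2 w2 k2 :
  yields s1 w1 k1 -> yields s2 w2 k2 -> yields (s1 ++ s2) (w1 ++ w2) (k1 + k2).
Proof.
move=> h h2; elim: h => //= [a s w k _ IH | X rhs s w k w' k' Xr h _ _ IH].
  exact: yields_term IH.
rewrite -catA !addSn -addnA; exact: yields_nonterm Xr h IH.
Qed.

Lemma yields_split s1 s2 w k : yields (s1 ++ s2) w k ->
  exists w1 w2 k1 k2,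
    [/\ w = w1 ++ w2, k = k1 + k2, yields s1 w1 k1 & yields s2 w2 k2].
Proof.
elim: s1 w k => [|[X|a] s1 IH] w k /=.
- by move=> h; exists [::], w, 0, k; split=> //; exact: yields_nil.
- case/yields_nontermE=> rhs [w1 [k1 [w2 [k2 [-> -> Xr h1]]]]].
  case/IH=> w3 [w4 [k3 [k4 [-> -> h3 h4]]]].
  exists (w1 ++ w3), w4, (k1 + k3).+2, k4; split=> //; rewrite ?catA ?addnA //.
  exact: yields_nonterm Xr h1 h3.
- case/yields_termE=> w1 [k1 [-> ->]] /IH[w3 [w4 [k3 [k4 [-> -> h3 h4]]]]].
  by exists (a :: w3), w4, k3.+1, k4; split=> //; exact: yields_term.
Qed.

Lemma cderives_cat u v s t : cderives s t -> cderives (u ++ s ++ v) (u ++ t ++ v).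
Proof.
elim=> {s t} [s|s1 s2 s3 [u' v' X rhs Xr] _ IH]; first exact: cderives_refl.
apply: cderives_step IH.
have -> : u ++ (u' ++ inl X :: v') ++ v = (u ++ u') ++ inl X :: (v' ++ v).
  by rewrite -!catA.
have -> : u ++ (u' ++ rhs ++ v') ++ v = (u ++ u') ++ rhs ++ (v' ++ v).
  by rewrite -!catA.
exact: cstep_rule.
Qed.

Lemma cderives_trans s t r : cderives s t -> cderives t r -> cderives s r.
Proof.
by elim=> // s1 s2 s3 st _ IH /IH; exact: cderives_step.
Qed.

Lemma cderivesP s w : cderives s (map inr w) <-> exists k, yields s w k.
Proof.
split=> [|[k]].
  move wE: (map inr w) => r h; elim: h wE => {s r} [_ <-|s1 s2 r st _ IH /IH[k]].
    elim: w => [|a w [k h]]; first by exists 0; exact: yields_nil.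
    by exists k.+1; apply: yields_term.
  case: st => u v X rhs Xr /yields_split[w1 [w' [k1 [k' [-> _ h1]]]]].
  case/yields_split=> w2 [w3 [k2 [k3 [-> _ h2 h3]]]].
  by eexists; apply: yields_cat h1 _; apply: (yields_nonterm Xr h2 h3).
elim=> {s w k} [|a s w k _ IH|X rhs s w1 k1 w2 k2 Xr _ IH1 _ IH2].
- exact: cderives_refl.
- by have := cderives_cat [:: inr a] [::] IH; rewrite !cats0.
- apply: (@cderives_step _ _ _ (rhs ++ s)).
    exact: (@cstep_rule _ _ [::] s).
  rewrite map_cat; apply: (@cderives_trans _ (map inr w1 ++ s)).
    exact: (cderives_cat [::] s IH1).
  by have := cderives_cat (map inr w1) [::] IH2; rewrite !cats0.
Qed.

Lemma cfg_langP w : cfg_lang g w <-> exists k, yields [:: inl (cstart g)] w k.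
Proof. exact: cderivesP. Qed.

End Yields.

(** * The grammar of balanced runs *)

Section BalancedGrammar.
Variables (Sigma T S : finType).
Variable rd : S -> option Sigma -> S -> bool.
Variable lt : S -> T * bool -> S -> bool.
Variables (s0 : S) (F : {set S}).

(* [Some (s, t)] generates the words read by balanced runs from [s] to [t]. *)
Definition bal_nonterm : finType := option (S * S).

Definition bal_rule (X : bal_nonterm) (rhs : seq (bal_nonterm + Sigma)) : bool :=
  match X, rhs with
  | None, [:: inl (Some (s, t))] => (s == s0) && (t \in F)
  | Some (s, t), [::] => s == t
  | Some (s, t), [:: inl (Some (s1, t1))] => (t1 == t) && rd s None s1
  | Some (s, t), [:: inr a; inl (Some (s1, t1))] => (t1 == t) && rd s (Some a) s1
  | Some (s, t), [:: inl (Some (s1, s2)); inl (Some (s3, t1))] =>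
      (t1 == t) && [exists l, lt s l s1 && lt s2 (sinv l) s3]
  | _, _ => false
  end.

(** Right-hand sides have at most two symbols, so the rules can be filtered out of a finite type. *)
Definition bal_grammar : cfg Sigma :=
  @CFG Sigma bal_nonterm None
    [seq (p.1, val p.2) | p <- enum {: bal_nonterm * 2.-bseq (bal_nonterm + Sigma)}
                        & bal_rule p.1 (val p.2)].

Lemma bal_rulesP X rhs :
  reflect (bal_rule X rhs) ((X, rhs) \in crules bal_grammar).
Proof.
apply: (iffP mapP) => [[[Y r]]|Xr].
  by rewrite mem_filter => /andP[/= Yr _] [-> ->].
have rhs2 : size rhs <= 2.
  by case: X Xr => [[s t]|]; case: rhs => // x [|y [|z rhs]] //=;
     repeat (case: x => [[[? ?]|]|?] //); repeat (case: y => [[[? ?]|]|?] //).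
by exists (X, Bseq rhs2) => //; rewrite mem_filter mem_enum /= Xr.
Qed.

Lemma balanced_yields s w n t : balanced rd lt s w n t ->
  exists k, yields (g := bal_grammar) [:: inl (Some (s, t))] w k.
Proof.
elim=> {s w n t} [s|s o s1 w n t rs _ [k h]|].
- exists 2; apply: yields1 (yields_nil _); apply/bal_rulesP; exact: eqxx.
- case: o rs => [a|] rs.
    eexists; apply: yields1 (yields_term a h).
    by apply/bal_rulesP; rewrite /= eqxx rs.
  by eexists; apply: yields1 h; apply/bal_rulesP; rewrite /= eqxx rs.
- move=> s l s1 w1 n1 s2 s3 w2 n2 t l1 _ [k1 h1] l2 _ [k2 h2].
  eexists; apply: yields1 (yields_cat h1 h2); apply/bal_rulesP.
  by rewrite /= eqxx; apply/existsP; exists l; rewrite l1 l2.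
Qed.

(** The intended meaning of each nonterminal; the grammar is sound because every rule respects
    it. *)
Definition bal_sem (X : bal_nonterm) (w : seq Sigma) : Prop :=
  if X is Some (s, t) then exists n, balanced rd lt s w n t
  else exists2 t, t \in F & exists n, balanced rd lt s0 w n t.

Fixpoint bal_sem_seq (r : seq (bal_nonterm + Sigma)) (w : seq Sigma) : Prop :=
  match r with
  | [::] => w = [::]
  | inr a :: r' => exists2 w', w = a :: w' & bal_sem_seq r' w'
  | inl X :: r' => exists w1 w2, [/\ w = w1 ++ w2, bal_sem X w1 & bal_sem_seq r' w2]
  end.

Lemma bal_sem_rule X rhs w : bal_rule X rhs -> bal_sem_seq rhs w -> bal_sem X w.
Proof.
case: X => [[s t]|]; last first.
  case: rhs => [|[[[s t]|]|a] []] //= /andP[/eqP -> Ft] [w1 [w2 [-> h ->]]].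
  by rewrite cats0; exists t.
case: rhs => [|[[[s1 t1]|]|a] [|[[[s3 t3]|]|b] []]] //=.
- by move=> /eqP -> ->; exists 0; exact: bal_nil.
- move=> /andP[/eqP -> rs] [w1 [w2 [-> [n h] ->]]]; rewrite cats0.
  by exists n.+1; exact: (bal_read (o := None) rs h).
- case/andP=> /eqP -> /existsP[l /andP[l1 l2]] [w1 [w' [-> [n1 h1]]]].
  move=> [w2 [w3 [-> [n2 h2] ->]]]; rewrite cats0.
  by eexists; apply: bal_pair l1 h1 l2 h2.
- case/andP=> /eqP -> rs [w' -> [w1 [w2 [-> [n h] ->]]]]; rewrite cats0.
  by exists n.+1; exact: (bal_read (o := Some a) rs h).
Qed.

Lemma yields_bal_sem r w k : yields (g := bal_grammar) r w k -> bal_sem_seq r w.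
Proof.
elim=> {r w k} //= [a r w k _ IH|X rhs r w1 k1 w2 k2 /bal_rulesP Xr _ IH1 _ IH2].
  by exists w.
by exists w1, w2; split=> //; exact: bal_sem_rule IH1.
Qed.

Lemma bal_grammar_lang w : cfg_lang bal_grammar w <->
  exists2 t, t \in F & exists n, balanced rd lt s0 w n t.
Proof.
rewrite cfg_langP; split=> [[k /yields_bal_sem[w1 [w2 [-> h ->]]]]|].
  by rewrite cats0.
case=> t Ft [n /balanced_yields[k h]]; eexists; apply: yields1 h.
by apply/bal_rulesP; rewrite /= eqxx.
Qed.

End BalancedGrammar.

(** * Linear cost of derivations *)

Lemma uniform_bound (I : finType) (P : I -> nat -> Prop) :
  (forall i m n, m <= n -> P i m -> P i n) ->
  exists K, forall i n, P i n -> P i K.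
Proof.
move=> Pmono.
suff [K HK] : exists K, forall i, i \in enum I -> forall n, P i n -> P i K.
  by exists K => i; apply: HK; rewrite mem_enum.
elim: (enum I) => [|i s [K HK]]; first by exists 0.
(* An index may have no bound at all, and [P] is not decidable, hence the excluded middle. *)
have [[m Pm]|noP] := classic (exists m, P i m); last first.
  exists K => j; rewrite inE => /orP[/eqP -> n Pn|/HK //].
  by case: noP; exists n.
exists (maxn m K) => j; rewrite inE => /orP[/eqP -> n _|/HK h n /h].
  by apply: Pmono Pm; exact: leq_maxl.
by apply: Pmono; exact: leq_maxr.
Qed.

Section LinearCost.
Variables (Sigma : finType) (g : cfg Sigma).
Implicit Types (X Y : nonterm g) (s : seq (nonterm g + Sigma)) (w : seq Sigma).

Definition rhs_bound := \max_(r <- crules g) size r.2.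

Lemma rhs_boundP X rhs : (X, rhs) \in crules g -> size rhs <= rhs_bound.
Proof. by move=> Xr; apply: (bigmaxn_sup_seq (X, rhs)). Qed.

Definition yields_le s w b := exists2 k, k <= b & yields s w k.

Lemma yields_leW s w b c : b <= c -> yields_le s w b -> yields_le s w c.
Proof. by move=> bc [k kb h]; exists k => //; apply: leq_trans bc. Qed.

Lemma yields_le_cat s1 w1 b1 s2 w2 b2 : yields_le s1 w1 b1 ->
  yields_le s2 w2 b2 -> yields_le (s1 ++ s2) (w1 ++ w2) (b1 + b2).
Proof.
move=> [k1 kb1 h1] [k2 kb2 h2]; exists (k1 + k2); first exact: leq_add.
exact: yields_cat.
Qed.

Definition yields_dominates K X Y :=
  forall w k, yields [:: inl Y] w k -> yields_le [:: inl X] w (k + K).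

Section Bounds.
Variables E C n : nat.
Hypothesis C_gt0 : 0 < C.
Hypothesis null_bound : forall X k, yields [:: inl X] [::] k -> yields_le [:: inl X] [::] E.
Hypothesis short_bound : forall X w k, 0 < size w < n -> yields [:: inl X] w k ->
  yields_le [:: inl X] w (C * (2 * size w - 1)).

Lemma yields_term_le a s w b : yields_le s w b -> yields_le (inr a :: s) (a :: w) b.+1.
Proof. by case=> k kb h; exists k.+1 => //; exact: yields_term. Qed.

(** The share [E.+1] of each symbol pays for an erased nonterminal or for a terminal. For nonempty
    pieces of sizes a and b, (2a - 1) + (2b - 1) = 2(a + b) - 2, so splitting a word never raises
    the bound and even leaves one [C] over. *)
Lemma yields_short_bound s w k : size w < n -> yields s w k ->
  yields_le s w (E.+1 * size s + C * (2 * size w - 1)).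
Proof.
elim: s w k => [|[X|a] s IH] w k wn h.
- by have [-> _] := yields_nilE h; exists 0 => //; exact: yields_nil.
- have [w1 [w2 [k1 [k2 [wE _ h1 h2]]]]] := @yields_split _ _ [:: inl X] s _ _ h.
  subst w; rewrite size_cat in wn *.
  have {}h2 := IH _ _ (leq_ltn_trans (leq_addl _ _) wn) h2.
  case: w1 => [|a w1] in h h1 wn *.
    by apply: yields_leW (yields_le_cat (null_bound h1) h2); rewrite /=; lia.
  have {}h1 := short_bound (w := a :: w1) (leq_ltn_trans (leq_addr _ _) wn) h1.
  apply: yields_leW (yields_le_cat h1 h2); rewrite /=; nia.
- have [w' [k' [wE _ h']]] := yields_termE h; subst w.
  apply: yields_leW (yields_term_le a (IH _ _ (ltnW wn) h')); rewrite /=; nia.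
Qed.

(* In the second case every part of the word is shorter than [n], which saves
   the room [C] for a rule and a chain of unit steps above it. *)
Lemma yields_unit_or_bound s w k : size w = n -> 0 < n -> yields s w k ->
  (exists u X v k1 k2 k3,
     [/\ s = u ++ inl X :: v, yields u [::] k1, yields [:: inl X] w k2,
         yields v [::] k3 & k2 <= k])
  \/ yields_le s w (E.+1 * size s + C * (2 * n - 2)).
Proof.
move=> wn n0; elim: s k => [|[X|a] s IH] k h.
- by have [w0 _] := yields_nilE h; rewrite w0 in wn; rewrite -wn in n0.
- have [w1 [w2 [k1 [k2 [wE kE h1 h2]]]]] := @yields_split _ _ [:: inl X] s _ _ h.
  case: w1 => [|a w1] in wE h1.
    rewrite /= in wE; subst w2.
    have [[u [Y [v [l1 [l2 [l3 [-> hu hY hv ll]]]]]]]|b] := IH _ h2; [left|right].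
      exists (inl X :: u), Y, v, (k1 + l1), l2, l3; split=> //; last by lia.
      exact: (yields_cat h1 hu).
    by apply: yields_leW (yields_le_cat (null_bound h1) b); rewrite /=; lia.
  case: w2 => [|b w2] in wE h2.
    left; exists [::], X, s, 0, k1, k2; split=> //; last by lia.
      exact: yields_nil.
    by rewrite wE cats0.
  right; have wE2 : size (a :: w1) + size (b :: w2) = n by rewrite -wn wE size_cat.
  have {}h1 : yields_le _ _ _ := short_bound (k := k1) (w := a :: w1) _ h1.
  have {}h2 := yields_short_bound (w := b :: w2) _ h2.
  rewrite wE; apply: yields_leW (yields_le_cat (h1 _) (h2 _)).
  - by move: wE2 => /=; nia.
  - by move: wE2 => /=; lia.
  - by move: wE2 => /=; lia.
- right; have [w' [k' [wE _ h']]] := yields_termE h; rewrite wE.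
  have w'n : (size w').+1 = n by rewrite -wn wE.
  have b := yields_short_bound (w := w') _ h'.
  apply: yields_leW (yields_term_le a (b _)); last by lia.
  by rewrite /=; nia.
Qed.

(** Induction on the cost, which drops at each unit step; the chain ends at a [Y] whose rule falls
    under the second case of [yields_unit_or_bound]. The overhead [K] counts the erased neighbours
    and the rules of the chain, and still depends on the derivation. *)
Lemma yields_peel X w k : size w = n -> 0 < n -> yields [:: inl X] w k ->
  exists Y K, yields_dominates K X Y /\
    yields_le [:: inl Y] w ((E.+1 * rhs_bound + C * (2 * n - 2)).+2).
Proof.
move=> wn n0; have [m] := ubnP k; elim: m X k => // m IH X k km h.
have [rhs [k' [kE Xr h']]] := yields1E h.
have [[u [Y [v [k1 [k2 [k3 [rE hu hY hv k2k]]]]]]]|[l lb hl]] := yields_unit_or_bound wn n0 h'.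
  have [|Z [K [KZ hZ]]] := IH Y k2 _ hY; first by lia.
  exists Z, (k1 + k3 + K).+2; split=> // w1 l1 /KZ[l lb hl].
  exists (k1 + (l + k3)).+2; first by lia.
  apply: yields1 Xr _; rewrite rE -[w1]/([::] ++ w1); apply: yields_cat hu _.
  by rewrite -[w1]cats0; exact: (yields_cat hl hv).
exists X, 0; split; first by move=> w1 k1 h1; exists k1 => //; rewrite addn0.
exists l.+2; last exact: yields1 Xr hl.
rewrite !ltnS; apply: leq_trans lb _.
by rewrite leq_add2r leq_mul2l (rhs_boundP Xr) orbT.
Qed.

End Bounds.

Lemma yields_linear : exists E C, forall X w k, yields [:: inl X] w k ->
  yields_le [:: inl X] w (E + C * size w).
Proof.
have [E HE] := @uniform_bound (nonterm g) (fun X b => yields_le [:: inl X] [::] b)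
  (fun X b c => @yields_leW _ _ b c).
have [|K HK] := @uniform_bound (nonterm g * nonterm g)%type
  (fun p K => yields_dominates K p.1 p.2).
  by move=> p b c bc h w k /h; apply: yields_leW; rewrite leq_add2l.
have null X k (h : yields [:: inl X] [::] k) : yields_le [:: inl X] [::] E.
  by apply: (HE X k); exists k.
(* The price of one rule application together with the chain of unit steps above it, that is, the
   gap between [C * (2 * n - 2)] and [C * (2 * n - 1)]. *)
pose C := (E.+1 * rhs_bound + K).+2.
have main n X w k : size w = n -> 0 < n -> yields [:: inl X] w k ->
    yields_le [:: inl X] w (C * (2 * n - 1)).
  have [m] := ubnP n; elim: m n X w k => // m IH n X w k nm wn n0 h.
  have short Y w' k' : 0 < size w' < n -> yields [:: inl Y] w' k' ->
      yields_le [:: inl Y] w' (C * (2 * size w' - 1)).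
    by case/andP=> w0 w'n; apply: (IH (size w')) => //; lia.
  have [Y [K' [dom [l lb hl]]]] := @yields_peel E C n isT null short X w k wn n0 h.
  (* The overhead [K'] of this particular chain is replaced by [K], which is uniform over the
     finitely many pairs of nonterminals. *)
  have [l' l'b hl'] := HK (X, Y) _ dom _ _ hl.
  exists l' => //; apply: leq_trans l'b _; rewrite /C in lb *; nia.
exists E, (2 * C) => X w k h; case: (posnP (size w)) => [/size0nil w0|w0].
  by rewrite w0 muln0 addn0 in h *; exact: null h.
by apply: yields_leW (main _ _ _ _ erefl w0 h); nia.
Qed.

End LinearCost.

(** * The dotted-item parser *)

Section DottedItems.
Variables (Sigma : finType) (g : cfg Sigma).
Local Notation symbol := (nonterm g + Sigma)%type.

(** The successor leaves room for the one-symbol initial item even if all right-hand sides are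
    empty. *)
Definition dot_bound := (rhs_bound g).+1.

(* The dotted item X -> u . v, of which only [X] and [v] are remembered. *)
Definition item : finType := (nonterm g * dot_bound.-bseq symbol)%type.

Definition dot (X : nonterm g) (v : seq symbol) : item := (X, insub_bseq dot_bound v).

Definition dot_read (s : item) (o : option Sigma) (t : item) : bool :=
  (s.1 == t.1) && (if o is Some a then s.2 == inr a :: t.2 :> seq symbol else false).

(* The item is pushed before the nonterminal after its dot is expanded, and
   popped when that expansion is completed. *)
Definition dot_letter (s : item) (l : item * bool) (t : item) : bool :=
  if l.2 then [&& nilp s.2, l.1.1 == t.1 & l.1.2 == inl s.1 :: t.2 :> seq symbol]
  else [&& l.1 == s, ohead s.2 == Some (inl t.1) & (t.1, val t.2) \in crules g].

Lemma val_dot X v : size v <= dot_bound -> (dot X v).2 = v :> seq symbol.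
Proof. by move=> vb; rewrite /dot /= /insub_bseq insubdK. Qed.

(* A balanced run only shortens the part after the dot, so that a popped item
   cannot be pushed back: the pairs [p^-1 ... p] do not occur. *)
Lemma balanced_dot s w n t : balanced dot_read dot_letter s w n t ->
  s.1 = t.1 /\ exists2 u, s.2 = u ++ t.2 :> seq symbol & yields u w n.
Proof.
elim=> {s w n t} [s|s o s1 w n t rs _ [st [u uE hu]]|].
- by split=> //; exists [::] => //; exact: yields_nil.
- case: o rs => [a|] /andP[/eqP ss1 // /eqP sE].
  split; first by rewrite ss1.
  by exists (inr a :: u); [rewrite sE uE | exact: yields_term].
- move=> s [p []] s1 w1 n1 s2 s3 w2 n2 t /=; rewrite /dot_letter /=.
    case/and3P=> _ _ /eqP pE _ [_ [u uE _]] /and3P[/eqP ps2 _ _].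
    by move: (congr1 size pE); rewrite ps2 /= uE size_cat; lia.
  case/and3P=> /eqP -> sY Yr _ [s12 [u uE hu]] /and3P[/nilP s20 /eqP s13 /eqP sE].
  move=> _ [s3t [v vE hv]]; split; first by rewrite s13.
  exists (inl s2.1 :: v); first by rewrite sE vE.
  by rewrite s20 cats0 in uE; apply: yields_nonterm hu hv; rewrite -uE -s12.
Qed.

(** The remainder [v] is general: it is empty when the induction enters the expansion of a
    nonterminal, and is kept along the rest of the rule. *)
Lemma yields_balanced_dot u w n : yields u w n -> forall X v,
  size (u ++ v) <= dot_bound ->
  balanced dot_read dot_letter (dot X (u ++ v)) w n (dot X v).
Proof.
elim=> {u w n} [|a u w n _ IH|Y rhs u w1 n1 w2 n2 Yr _ IH1 _ IH2] X v ub /=.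
- exact: bal_nil.
- apply: (bal_read (o := Some a)) (IH X v (ltnW ub)).
  by rewrite /dot_read eqxx !val_dot //=; exact: ltnW.
- have rb : size rhs <= dot_bound by exact: leq_trans (rhs_boundP Yr) (leqnSn _).
  have := IH1 Y [::]; rewrite cats0 => /(_ rb) h1.
  apply: (bal_pair (l := (dot X (inl Y :: u ++ v), false)) _ h1 _ (IH2 X v (ltnW ub))).
    by rewrite /dot_letter /= eqxx !val_dot //= eqxx.
  by rewrite /dot_letter /= !val_dot //= ?eqxx //; exact: ltnW.
Qed.

(** The initial item has the start symbol S in front of itself, whether or not S -> S is a rule. The
    accepting item also arises whenever an inner S is completed; the trivial register tells the
    outermost completion apart. *)
Definition item_aut : gautomaton F2 Sigma :=
  labelled_aut dot_read dot_letter (dot (cstart g) [:: inl (cstart g)])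
    [set dot (cstart g) [::]].

Lemma item_aut_accepts w k :
  gaccepts_in F2_mul F2_one item_aut w k <-> yields [:: inl (cstart g)] w k.
Proof.
rewrite labelled_aut_accepts; split=> [[t]|h].
  rewrite inE => /eqP -> /balanced_dot[_ [u]].
  by rewrite !val_dot // cats0 => <-.
exists (dot (cstart g) [::]); first by rewrite inE.
exact: (@yields_balanced_dot _ _ _ h (cstart g) [::] isT).
Qed.

End DottedItems.

Theorem theorem4p6 (Sigma : finType) (L : seq Sigma -> Prop) :
  in_LGw_lin F2_mul F2_one L <-> is_CF L.
Proof.
split=> [[A [t [LA _ _]]]|[g Lg]].
  exists (bal_grammar (@pend_read _ A) (@pend_letter _ A)
            (pending (ginit A) [::]) (pend_acc A)) => w.
  rewrite LA gaccepts_pend bal_grammar_lang.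
  by split=> [[s [k [Fs h]]]|[s Fs [k h]]]; exists s => //; exists k.
have [E [C EC]] := yields_linear g.
exists (item_aut g), (fun n => E + C * n); split.
- move=> w; rewrite Lg cfg_langP.
  by split=> -[k h]; exists k; apply/item_aut_accepts.
(* The constant [E] is absorbed into [E * n] as soon as [n] is positive. *)
- by exists (E + C), 1 => n n0; nia.
- move=> w /Lg /cfg_langP[k /EC[k' k'b h]].
  by exists k' => //; apply/item_aut_accepts.
Qed.
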